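(* Let $\mu\in\mathcal P$ and let $f$ be as in the context, with $f'(\infty)=\infty$. Assume that $\theta\in L^1_+$ with $S\theta\in L^1$ and constants $\lambda,\eta\in\mathbb R$ satisfy \[ -\lambda-\eta S(u)\in\partial f\bigl(\theta(u)\bigr)\ \text{ for $\mu$-almost every }u,\qquad \int_{[0,\rho)}\theta(u)\,\mu(\mathrm{d}u)=1,\qquad \int_{[0,\rho)}S(u)\theta(u)\,\mu(\mathrm{d}u)=0, \] and define the measure $\nu(\mathrm{d}x)=\theta(x)\mu(\mathrm{d}x)$. Then $\nu$ solves Problem (G), i.e. $\nu$ minimizes $D_f(\cdot\,\Vert\,\mu)$ over $\mathcal P_\mu$. Moreover: (i) If $m^\mu>0$, Problem (G) has at least one solution $\hat\nu$ such that $\mu\succeq\hat\nu$. (ii) If $m^\mu<0$, Problem (G) has at least one solution $\hat\nu$ such that $\hat\nu\succeq\mu$.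
   Context: Scale function: $I=(\ell,\rho)$ with $-\infty\le\ell<0<r_0<\rho\le\infty$; $a,\sigma:I\to\mathbb R$ are Borel, $\sigma^2>0$ on $I$, and $1/\sigma^2$, $|a|/\sigma^2$ are locally integrable on $I$; $S(x):=\int_{r_0}^x\exp\{-2\int_{r_0}^u\frac{a(r)}{\sigma^2(r)}\mathrm{d}r\}\mathrm{d}u$ for $x\in I$. Thus $S$ is continuous and strictly increasing with $S(r_0)=0$. $\mathcal P$ is the set of probability measures $\nu$ on $[0,\rho)$ with $\int_{[0,\rho)}|S|\,\mathrm{d}\nu<\infty$; for $\nu\in\mathcal P$, $m^\nu:=\int_{[0,\rho)}S(u)\,\nu(\mathrm{d}u)$. $\mathcal P_\mu:=\{\nu\in\mathcal P:m^\nu=0\}$. $L^1:=L^1([0,\rho),\mathcal B([0,\rho)),\mu)$, and $L^1_+$ is its cone of nonnegative functions. Stochastic dominance: $\nu\succeq\mu$ means $\nu((-\infty,x])\le\mu((-\infty,x])$ for all $x\in\mathbb R$. Divergence: $f:(0,\infty)\to\mathbb R$ is convex, extended by $f(0):=\lim_{x\downarrow0}f(x)\in(-\infty,\infty]$ and $f(x)=\infty$ for $x<0$; $f'(\infty):=\lim_{x\to\infty}f(x)/x$. Standing assumption: $f\ge0$, $f(1)=0$ (and $f'(\infty)\geq 0$). For $\nu\in\mathcal P$ with Lebesgue decomposition $\nu=\theta\mu+\nu^\perp$ with respect to $\mu$, $D_f(\nu\,\Vert\,\mu):=\int_{[0,\rho)}f(\theta)\,\mathrm{d}\mu+f'(\infty)\,\nu^\perp([0,\rho))$,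 with $a\cdot\infty=0$ if $a=0$ and $a\cdot\infty=\infty$ if $a>0$. (So for $f'(\infty)=\infty$ measures with nonzero singular part have infinite divergence.) Subdifferential: for $x\ge0$ with $f(x)<\infty$, $\partial f(x):=\{z\in\mathbb R: f(y)\ge f(x)+z(y-x)\ \text{for all }y\in\mathbb R\}$; $\partial f(x):=\emptyset$ if $f(x)=\infty$. Problem (G): minimize $D_f(\nu\,\Vert\,\mu)$ over $\nu\in\mathcal P_\mu$. *)

(* Defs.v *)
From HB Require Import structures.
From mathcomp Require Import all_boot all_order all_algebra.
From mathcomp Require Import all_classical all_reals all_analysis.
From mathcomp Require Import measurable_realfun.

Set Implicit Arguments.
Unset Strict Implicit.
Unset Printing Implicit Defensive.

Import Order.TTheory GRing.Theory Num.Theory.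
Import numFieldNormedType.Exports.

Local Open Scope classical_set_scope.
Local Open Scope ring_scope.

Section lebesgue_decomposition.
Context d (T : measurableType d) (R : realType).
Local Open Scope ereal_scope.
Implicit Types nu mu : {finite_measure set T -> \bar R}.

(* [nu = theta mu + nup] with [nup] singular to [mu]; the witness [N] below
   carries [nup] and is [mu]-null. *)
Definition is_lebesgue_decomposition nu mu
    (theta : T -> R) (nup : {measure set T -> \bar R}) : Prop :=
  [/\ measurable_fun setT theta,
      forall x, (0 <= theta x)%R,
      exists N, [/\ measurable N, mu N = 0 & nup (~` N) = 0] &
      forall A, measurable A ->
        nu A = \int[mu]_(x in A) (theta x)%:E + nup A].

Lemma null_set_maximal nu mu : exists N, [/\ measurable N, mu N = 0 &
  forall A, measurable A -> mu A = 0 -> nu A <= nu N].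
Proof.
pose V := [set nu A | A in [set A | measurable A /\ mu A = 0]].
pose s := ereal_sup V.
have V0 : V (nu set0) by exists set0 => //; split => //; rewrite measure0.
have s_fin : s \is a fin_num.
  rewrite ge0_fin_numE; last first.
    by apply: ereal_sup_ubound; exists set0 => //; split => //; rewrite measure0.
  apply: (@le_lt_trans _ _ (nu setT)); last by rewrite ltey_eq fin_num_measure.
  apply: ge_ereal_sup => _ [A [mA _] <-].
  by apply: le_measure; rewrite ?inE.
have /choice[F FE] (n : nat) : exists A,
    [/\ measurable A, mu A = 0 & s - n.+1%:R^-1%:E < nu A].
  have : s - n.+1%:R^-1%:E < s.
    by rewrite lteBlDr ?fin_numE// lteDl ?lte_fin ?invr_gt0.
  by move=> /ereal_sup_gt[_ [A [mA A0] <-]] h; exists A.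
have mF n : measurable (F n) by case: (FE n).
have mU : measurable (\bigcup_n F n) by exact: bigcup_measurable.
have U0 : mu (\bigcup_n F n) = 0.
  apply/eqP; rewrite eq_le measure_ge0 andbT.
  have := @measure_sigma_subadditive _ _ _ mu _ _ mF mU (@subset_refl _ _).
  move=> /le_trans; apply.
  by rewrite eseries0// => n _ _; case: (FE n).
exists (\bigcup_n F n); split => // A mA A0.
apply: (@le_trans _ _ s); first by apply: ereal_sup_ubound; exists A.
apply/lee_addgt0Pr => e e0.
have [n ne] : exists n, (n.+1%:R^-1 < e)%R.
  have [n _ /(_ n (leqnn _)) h] := near_infty_natSinv_lt (PosNum e0).
  by exists n.
have [_ _ h] := FE n.
rewrite -leeBlDr//.
apply: (@le_trans _ _ (s - n.+1%:R^-1%:E)).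
  by rewrite leeB// lee_fin ltW.
apply: (le_trans (ltW h)).
by apply: le_measure; rewrite ?inE//; exact: bigcup_sup.
Qed.

Lemma lebesgue_decomposition_exists nu mu :
  exists p : (T -> R) * {measure set T -> \bar R},
    is_lebesgue_decomposition nu mu p.1 p.2.
Proof.
have [N [mN N0 Nmax]] := null_set_maximal nu mu.
have mCN : measurable (~` N) by exact: measurableC.
have nuCNoo : nu (~` N) < +oo by rewrite ltey_eq fin_num_measure.
pose nua : {finite_measure set T -> \bar R} := mfrestr mCN nuCNoo.
have nuaE A : nua A = nu (A `&` ~` N) by [].
have dom : nua `<< mu.
  apply/null_content_dominatesP => A mA A0; rewrite nuaE.
  have mAN : measurable (A `&` ~` N) by exact: measurableI.
  have AN0 : mu (A `&` ~` N) = 0.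
    apply/eqP; rewrite eq_le measure_ge0 andbT -A0.
    by apply: le_measure; rewrite ?inE.
  have muU : mu ((A `&` ~` N) `|` N) = 0 by rewrite measureU0.
  have nuU : nu ((A `&` ~` N) `|` N) = nu (A `&` ~` N) + nu N.
    by rewrite measureU//; rewrite -setIA setICl setI0.
  have h := Nmax _ (measurableU _ _ mAN mN) muU.
  apply/eqP; rewrite eq_le measure_ge0 andbT.
  by move: h; rewrite nuU -leeBrDr ?fin_num_measure// subee ?fin_num_measure.
have [g [g0 gfin ig gE]] := radon_nikodym_sigma_finite dom.
exists (fine \o g, (mrestr nu mN : {measure set T -> \bar R})); split => /=.
- apply/measurable_EFinP.
  rewrite (_ : EFin \o _ = g); first exact: measurable_int ig.
  by apply/funext => x /=; rewrite fineK.
- by move=> x; exact: fine_ge0.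
- by exists N; split => //; rewrite /mrestr setICl measure0.
- move=> A mA; transitivity (nua A + nu (A `&` N)).
    by rewrite nuaE -setDE; exact: measureDI.
  rewrite gE//; congr (_ + _).
  by apply: eq_integral => x _; rewrite fineK.
Qed.

(* The decomposition is unique up to a [mu]-null modification of the density,
   so the divergence below does not depend on the choice made by [cid]. *)
Definition ac_density nu mu : T -> R :=
  (sval (cid (lebesgue_decomposition_exists nu mu))).1.

Definition singular_part nu mu : {measure set T -> \bar R} :=
  (sval (cid (lebesgue_decomposition_exists nu mu))).2.

Lemma lebesgue_decompositionP nu mu :
  is_lebesgue_decomposition nu mu (ac_density nu mu) (singular_part nu mu).
Proof. by rewrite /ac_density /singular_part; case: cid. Qed.

End lebesgue_decomposition.

Section scale_function.
Context {R : realType}.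

(* Oriented integral, with sign change for [b < a]. *)
Definition oriented_integral (a b : R) (g : R -> R) : R :=
  if a <= b then \int[lebesgue_measure]_(t in `[a, b]) g t
  else - \int[lebesgue_measure]_(t in `[b, a]) g t.

Definition state_space (l rho : \bar R) : set R :=
  [set x | (l < x%:E)%E /\ (x%:E < rho)%E].

Definition scale (a sigma : R -> R) (r0 x : R) : R :=
  oriented_integral r0 x (fun u =>
    expR (- 2 * oriented_integral r0 u (fun r => a r / sigma r ^+ 2))).

End scale_function.

Section divergence.
Context {R : realType}.
Implicit Types f : R -> R.

(* Only the values of [f] on ]0, +oo[ matter.  For [f] convex there, both limits
   exist in [\bar R], so the totalized [lim] is the true limit. *)
Definition f_ext f (x : R) : \bar R :=
  if 0 < x then (f x)%:E
  else if x == 0 then lim ((f y)%:E @[y --> 0^'+])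
  else +oo%E.

Definition f_slope_infty f : \bar R := lim ((f x / x)%:E @[x --> +oo]).

(* Empty at [x < 0], where [f_ext f x = +oo]. *)
Definition subdifferential f (x : R) : set R :=
  [set z | (f_ext f x < +oo)%E /\
    forall y, (f_ext f x + (z * (y - x))%:E <= f_ext f y)%E].

End divergence.

Section problem.
Context {R : realType}.
Implicit Types (S f : R -> R) (rho : \bar R).
Implicit Types mu nu : probability (measurableTypeR R) R.

Definition nonneg_states rho : set (measurableTypeR R) :=
  [set x | 0 <= x /\ (x%:E < rho)%E].

(* Probability measures on [0, rho[ are the Borel probability measures on the
   line that are carried by [0, rho[. *)
Definition prob_class S rho : set (probability (measurableTypeR R) R) :=
  [set nu | nu (nonneg_states rho) = 1%E /\
            nu.-integrable (nonneg_states rho) (EFin \o S)].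

Definition mean S rho nu : R := \int[nu]_(u in nonneg_states rho) S u.

Definition centered_class S rho : set (probability (measurableTypeR R) R) :=
  [set nu | prob_class S rho nu /\ mean S rho nu = 0].

(* In [\bar R], [+oo * 0 = 0]. *)
Definition f_divergence f rho nu mu : \bar R :=
  (\int[mu]_(x in nonneg_states rho) f_ext f (ac_density nu mu x)
   + f_slope_infty f * singular_part nu mu (nonneg_states rho))%E.

Definition stoch_dominates nu mu : Prop :=
  forall x : R, (nu `]-oo, x]%classic <= mu `]-oo, x]%classic)%E.

Definition solves_G S f rho mu nu : Prop :=
  centered_class S rho nu /\
  forall nu', centered_class S rho nu' ->
    (f_divergence f rho nu mu <= f_divergence f rho nu' mu)%E.

(* [nu (dx) = theta x * mu (dx)] on [0, rho[, and no mass outside. *)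
Definition has_density rho mu (theta : R -> R) nu : Prop :=
  forall A, measurable A ->
    nu A = (\int[mu]_(x in A `&` nonneg_states rho) (theta x)%:E)%E.

End problem.

(* Main.v *)
Require Import Defs.
From HB Require Import structures.
From mathcomp Require Import all_boot all_order all_algebra.
From mathcomp Require Import all_classical all_reals all_analysis.
From mathcomp Require Import measurable_realfun.
From mathcomp Require Import ring lra.

Set Implicit Arguments.
Unset Strict Implicit.
Unset Printing Implicit Defensive.

Import Order.TTheory GRing.Theory Num.Theory.
Import numFieldNormedType.Exports.
Local Open Scope classical_set_scope.
Local Open Scope ring_scope.

(** Optimality of nu = theta mu is weak duality made pointwise.  If nu' is a
    competitor with density h', the subgradient inequality at theta(u) with
    slope - lambda - eta S(u) bounds f(h') from below by
    f(theta) + (- lambda - eta S) (h' - theta), and the linear term has zero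
    mu-integral because both densities have mass 1 and S-mean 0.  A competitor
    with a singular part has infinite divergence as f'(oo) = oo.  This is
    [foc_density_solves]; it applies to every density satisfying the
    first-order conditions, whatever its multipliers.

    For the dominance statements one needs such a density that is moreover
    monotone.  Let W = S if the mean of S is positive and W = - S if it is
    negative, so that the mean of W is positive in both cases, and look at the
    sign of the multiplier eta of W ([decreasing_foc_density]).
    - If eta > 0, subgradients of a convex function are monotone, hence theta is
      a decreasing function of W: theta itself will do.
    - If eta < 0, theta is an increasing function of W, so weighting by theta
      can only raise the mean of W (Chebyshev's inequality, [comonotone_mean]);
      this contradicts that the weighted mean is 0.
    - If eta = 0, testing the subgradient inequality at 1, where f vanishes,
      gives lambda = 0 and f(theta) = 0, so theta takes its values in the zero
      set [al, be] of f.  Any density of W-mean 0 with values there has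
      divergence 0 and is thus optimal.  Let g equal be below a quantile of W,
      al above it, with a value at the quantile that makes the mass 1.  As in
      the Neyman-Pearson lemma, g minimizes the mean of W, which is thus at most
      0; since the density 1 gives W a positive mean, a convex combination of g
      and 1 gives it mean 0.  It is decreasing in W and has values in [al, be]
      ([bang_bang]).

    Finally S is strictly increasing on [0, rho[, so a density that decreases in
    W decreases in the state if W = S, and increases in it if W = - S.  In the
    first case it exceeds 1 before it falls below 1, so that the mass it gives to
    ]-oo, x] is at least the mass given by mu; in the second case the same holds
    for the complement of ]-oo, x] ([decreasing_density_mass]). *)

(** * The extended generator of the divergence *)

Section divergence_generator.
Context {R : realType} (f : R -> R).
Hypothesis f_convex : convex_function (`]0, +oo[%classic : set R^o) f.
Hypothesis f_ge0 : forall x, 0 < x -> 0 <= f x.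
Hypothesis f1 : f 1 = 0.

(** Convexity in the form used below: it has no quotient, and no case analysis on
    coinciding points. *)
Lemma convex_secant (x y z : R) : 0 < x -> x <= y -> y <= z ->
  (z - x) * f y <= (z - y) * f x + (y - x) * f z.
Proof.
move=> x0 xy yz; have [xz|zx] := ltP x z; last first.
  have <- : x = y by lra.
  have <- : x = z by lra.
  by rewrite subrr !mul0r addr0.
have d0 : 0 < z - x by rewrite subr_gt0.
pose t := (z - y) / (z - x).
have t0 : 0 <= t by rewrite divr_ge0 ?subr_ge0// ltW.
have t1 : t <= 1 by rewrite ler_pdivrMr// mul1r lerD2l lerN2.
have inI (w : R) : 0 < w -> (w : R^o) \in (`]0, +oo[%classic : set R^o).
  by move=> w0; rewrite inE/= in_itv/= w0.
have : f (t * x + (1 - t) * z) <= t * f x + (1 - t) * f z.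
  exact: f_convex (Itv01 t0 t1) x z (inI _ x0) (inI _ (lt_trans x0 xz)).
have -> : t * x + (1 - t) * z = y by rewrite /t; field; rewrite gt_eqF.
rewrite -(ler_pM2l d0) => /le_trans; apply.
rewrite le_eqVlt; apply/orP; left; apply/eqP; rewrite /t; field.
by rewrite gt_eqF.
Qed.

(** As f is nonnegative and vanishes at 1, it has its minimum there; convexity
    makes it monotone on either side. *)
Lemma f_decr_before1 (x y : R) : 0 < x -> x <= y -> y <= 1 -> f y <= f x.
Proof.
move=> x0 xy y1; have := convex_secant x0 xy y1.
rewrite f1 mulr0 addr0 => h.
have [x1|x1] := ltP x 1; last first.
  by have -> : y = x by lra.
rewrite -(@ler_pM2l _ (1 - x)) ?subr_gt0//; apply: (le_trans h).
by rewrite ler_wpM2r ?f_ge0// lerD2l lerN2.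
Qed.

Lemma f_incr_after1 (x y : R) : 1 <= x -> x <= y -> f x <= f y.
Proof.
move=> x1 xy; have := convex_secant ltr01 x1 xy.
rewrite f1 mulr0 add0r => h.
have [y1|y1] := ltP 1 y; last first.
  by have -> : x = y by lra.
rewrite -(@ler_pM2l _ (y - 1)) ?subr_gt0//; apply: (le_trans h).
by rewrite ler_wpM2r ?f_ge0 ?lerD2r// (lt_le_trans ltr01 (ltW y1)).
Qed.

Lemma f_ext_pos x : 0 < x -> f_ext f x = (f x)%:E.
Proof. by rewrite /f_ext => ->. Qed.

Lemma f_ext_neg x : x < 0 -> f_ext f x = +oo%E.
Proof. by move=> x0; rewrite /f_ext ltNge (ltW x0)/= lt_eqF. Qed.

(** Since f decreases on ]0, 1[, the limit defining f(0) exists and is a supremum. *)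
Lemma f_ext0_sup :
  f_ext f 0 = ereal_sup ((EFin \o f) @` [set` Interval (BRight 0) (BLeft 1)]).
Proof.
rewrite /f_ext ltxx eqxx; apply/cvg_lim => //.
apply: (nonincreasing_at_right_cvge (BLeft 1)); first by rewrite bnd_simp.
move=> x y; rewrite !in_itv/= => /andP[x0 _] /andP[_ y1] xy.
by rewrite lee_fin f_decr_before1// ltW.
Qed.

Lemma f_ext1 : f_ext f 1 = 0%E. Proof. by rewrite f_ext_pos// f1. Qed.

Lemma f_ext_decr_before1 (x y : R) : x <= y -> y <= 1 ->
  (f_ext f y <= f_ext f x)%E.
Proof.
move=> xy y1; have [x0|x0|x0] := ltgtP x 0.
- by rewrite (f_ext_neg x0) leey.
- by rewrite !f_ext_pos ?lee_fin ?f_decr_before1// (lt_le_trans x0).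
- move: xy; rewrite x0 le_eqVlt => /predU1P[<-//|y0].
  have [y1'|y1'] := ltP y 1; last first.
    have -> : y = 1 by apply/eqP; rewrite eq_le y1.
    rewrite f_ext1 f_ext0_sup; apply: (@le_trans _ _ (f (2^-1))%:E).
      by rewrite lee_fin f_ge0.
    by apply: ereal_sup_ubound; exists 2^-1 => //=; rewrite in_itv/=; lra.
  rewrite f_ext_pos// f_ext0_sup; apply: ereal_sup_ubound; exists y => //=.
  by rewrite in_itv/= y0.
Qed.

Lemma f_ext_incr_after1 (x y : R) : 1 <= x -> x <= y ->
  (f_ext f x <= f_ext f y)%E.
Proof.
move=> x1 xy; have x0 : 0 < x := lt_le_trans ltr01 x1.
by rewrite !f_ext_pos ?lee_fin ?f_incr_after1// (lt_le_trans x0).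
Qed.

Lemma f_ext_ge0 x : (0 <= f_ext f x)%E.
Proof.
rewrite -f_ext1; have [x1|/ltW x1] := leP x 1; first exact: f_ext_decr_before1.
exact: f_ext_incr_after1.
Qed.

Lemma f_ext_quasiconvex (x y z : R) (c : \bar R) : x <= y -> y <= z ->
  (f_ext f x <= c)%E -> (f_ext f z <= c)%E -> (f_ext f y <= c)%E.
Proof.
move=> xy yz fx fz; have [y1|/ltW y1] := leP y 1.
  exact: le_trans (f_ext_decr_before1 xy y1) fx.
exact: le_trans (f_ext_incr_after1 y1 yz) fz.
Qed.

(** Sublevel sets are intervals, by quasi-convexity. *)
Lemma measurable_f_ext : measurable_fun setT (f_ext f).
Proof.
apply: (measurability _ (ErealGenInftyO.measurableE R)) => //.
move=> _ [_ [c ->] <-]; rewrite setTI.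
apply: is_interval_measurable => x z; rewrite /= !in_itv/= => fx fz y /andP[xy yz].
apply: (@le_lt_trans _ _ (Order.max (f_ext f x) (f_ext f z))).
  by apply: (f_ext_quasiconvex xy yz); rewrite le_max lexx ?orbT.
by rewrite gt_max fx.
Qed.

Lemma f_ext_fin_num x : (f_ext f x < +oo)%E -> f_ext f x \is a fin_num.
Proof. by move=> h; rewrite ge0_fin_numE// f_ext_ge0. Qed.

Lemma subdifferential_ge0 x z : subdifferential f x z -> 0 <= x.
Proof.
by case=> fx _; rewrite leNgt; apply/negP => /f_ext_neg fE; rewrite fE in fx.
Qed.

(** Monotonicity of the subdifferential: add the two subgradient inequalities. *)
Lemma subdifferential_le (x y z w : R) : subdifferential f x z ->
  subdifferential f y w -> x < y -> z <= w.
Proof.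
move=> [fx hx] [fy hy] xy.
have := hx y; have := hy x.
rewrite -(fineK (f_ext_fin_num fx)) -(fineK (f_ext_fin_num fy)) -!EFinD !lee_fin.
move=> h1 h2; rewrite -(@ler_pM2r _ (y - x)) ?subr_gt0//; lra.
Qed.

Lemma subdifferential0 x : f_ext f x = 0%E -> subdifferential f x 0.
Proof.
by move=> fx; split=> [|y]; rewrite fx// mul0r adde0 f_ext_ge0.
Qed.

(** The zero set is bounded since f grows superlinearly; its end points belong to it
    because a convex function is continuous at interior points, and f(0) is a
    limit. *)
Lemma zero_set_itv : f_slope_infty f = +oo%E ->
  exists al be : R, [/\ 0 <= al, al <= 1, 1 <= be &
    forall x, f_ext f x = 0%E <-> al <= x <= be].
Proof.
move=> f_infty.
pose Z := [set x | f_ext f x = 0%E].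
have Z1 : Z 1 by exact: f_ext1.
have Z_ge0 x : Z x -> 0 <= x.
  by move=> Zx; apply: (subdifferential_ge0 (subdifferential0 Zx)).
have Zconv x y z : Z x -> Z z -> x <= y -> y <= z -> Z y.
  move=> Zx Zz xy yz; apply/eqP; rewrite eq_le f_ext_ge0 andbT.
  by apply: (f_ext_quasiconvex xy yz); rewrite ?Zx ?Zz.
have Zlb : has_lbound Z by exists 0 => x; exact: Z_ge0.
have Zub : has_ubound Z.
  apply: contrapT => nub.
  have fz x : 1 <= x -> f x = 0.
    move=> x1; apply: EFin_inj; rewrite -f_ext_pos ?(lt_le_trans ltr01)//.
    have [z Zz xz] : exists2 z, Z z & x <= z.
      apply: contrapT => nz; apply: nub; exists x => z Zz.
      by rewrite leNgt; apply/negP => /ltW xz; apply: nz; exists z.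
    exact: Zconv Z1 Zz x1 xz.
  have : (f x / x)%:E @[x --> +oo] --> (0 : \bar R).
    apply: cvg_near_cst; exists 1; split=> // x /ltW x1.
    by rewrite fz ?mul0r.
  move=> /cvg_lim fl; move: f_infty; rewrite /f_slope_infty fl//.
have ne : Z !=set0 by exists 1.
exists (inf Z), (sup Z).
have iZ1 : inf Z <= 1 by apply: ge_inf.
have sZ1 : 1 <= sup Z by apply: ub_le_sup.
have iZ0 : 0 <= inf Z by apply: lb_le_inf => // x; exact: Z_ge0.
have supZ : Z (sup Z).
  apply: contrapT => nZ.
  have s0 : 0 < sup Z by lra.
  have v0 : 0 < f (sup Z).
    rewrite lt_neqAle f_ge0// andbT; apply/eqP => fs; apply: nZ.
    by rewrite /Z/= f_ext_pos// -fs.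
  have k0 : 0 <= f (sup Z + 1) by apply: f_ge0; lra.
  (* The secant over a zero y, sup Z and sup Z + 1 bounds f (sup Z) by
     (sup Z - y) * f (sup Z + 1); y is chosen too close to sup Z for that. *)
  have e0 : 0 < f (sup Z) / (f (sup Z + 1) + 1) by apply: divr_gt0 => //; lra.
  have [z Zz zs] := sup_adherent e0 (conj ne Zub).
  pose y := Num.max 1 z.
  have Zy : Z y by rewrite /y; case: leP.
  have y1 : 1 <= y by rewrite le_max lexx.
  have y0 : 0 < y by lra.
  have fy : f y = 0 by apply: EFin_inj; rewrite -f_ext_pos.
  have ys : y <= sup Z by apply: ub_le_sup.
  have := @convex_secant _ _ (sup Z + 1) y0 ys; rewrite fy mulr0 add0r.
  have zy : z <= y by rewrite le_max lexx orbT.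
  have : (sup Z - y) * (f (sup Z + 1) + 1) < f (sup Z).
    by rewrite -ltr_pdivlMr; lra.
  have : sup Z <= sup Z + 1 by lra.
  by move=> h1 h2 /(_ h1); nra.
have infZ : Z (inf Z).
  have [i0|i0] := leP (inf Z) 0; last first.
    apply: contrapT => nZ.
    have v0 : 0 < f (inf Z).
      rewrite lt_neqAle f_ge0// andbT; apply/eqP => fs; apply: nZ.
      by rewrite /Z/= f_ext_pos// -fs.
    have k0 : 0 <= f (inf Z / 2) by apply: f_ge0; lra.
    (* Same argument with the secant over inf Z / 2, inf Z and a zero y. *)
    have e0 : 0 < f (inf Z) * (inf Z / 2) / (f (inf Z / 2) + 1).
      by apply: divr_gt0; [apply: mulr_gt0|]; lra.
    have [y Zy ys] := inf_adherent e0 (conj ne Zlb).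
    have sy : inf Z <= y by apply: ge_inf.
    have y0 : 0 < y by lra.
    have fy : f y = 0 by apply: EFin_inj; rewrite -f_ext_pos.
    have h0 : 0 < inf Z / 2 by lra.
    have h1 : inf Z / 2 <= inf Z by lra.
    have := convex_secant h0 h1 sy; rewrite fy mulr0 addr0.
    have : (y - inf Z) * (f (inf Z / 2) + 1) < f (inf Z) * (inf Z / 2).
      by rewrite -ltr_pdivlMr; lra.
    have := mulr_ge0 (ltW v0) (_ : 0 <= y - inf Z).
    rewrite subr_ge0 => /(_ sy); nra.
  have iE : inf Z = 0 by apply/eqP; rewrite eq_le i0.
  apply/eqP; rewrite iE eq_le f_ext_ge0 andbT f_ext0_sup.
  apply: ge_ereal_sup => _ [x /= +] <-; rewrite in_itv/= => /andP[x0 x1].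
  have [z Zz] := inf_adherent x0 (conj ne Zlb); rewrite iE add0r => /ltW zx.
  have := Zconv _ _ _ Zz Z1 zx (ltW x1); rewrite /Z/= f_ext_pos// => ->.
  by [].
split=> // x; split=> [Zx|/andP[ax xb]]; last exact: Zconv infZ supZ ax xb.
by rewrite ge_inf//= ub_le_sup.
Qed.

End divergence_generator.

(** * Integrals on a carrier of a probability measure *)

Section probability_on_carrier.
Context d (T : measurableType d) (R : realType) (P : probability T R).
Variable D : set T.
Hypotheses (mD : measurable D) (PD : P D = 1%E).
Implicit Types (g h W theta : T -> R).

Local Notation "''E' g" := (\int[P]_(x in D) g x) (at level 10, g at level 8).
Local Notation L1 g := (P.-integrable D (EFin \o g)).

Let Rintegral_const c : \int[P]_(x in D) c = c.
Proof. by rewrite Rintegral_cst//= PD mulr1. Qed.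

Let integrable_const c : L1 (fun=> c).
Proof. by apply: finite_measure_integrable_cst => //=; rewrite PD ltry. Qed.

Lemma ae_eq_Rintegral g h : L1 g -> L1 h ->
  {ae P, forall x, D x -> g x = h x} -> 'E g = 'E h.
Proof.
move=> ig ih gh; congr fine; apply: ae_eq_integral => //.
- exact: measurable_int ig.
- exact: measurable_int ih.
- by apply: filterS gh => x gh Dx /=; rewrite gh.
Qed.

Lemma ae_ge0_Rintegral h : L1 h ->
  {ae P, forall x, D x -> 0 <= h x} -> 0 <= 'E h.
Proof.
move=> ih h0; rewrite (@ae_eq_Rintegral _ (fun x => `|h x|))//.
- exact: Rintegral_ge0.
- exact: integrable_norm.
- by apply: filterS h0 => x h0 Dx; rewrite ger0_norm// h0.
Qed.

Lemma ae_le_Rintegral g h : L1 g -> L1 h ->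
  {ae P, forall x, D x -> g x <= h x} -> 'E g <= 'E h.
Proof.
move=> ig ih gh; rewrite -subr_ge0 -RintegralB//.
apply: ae_ge0_Rintegral; first exact: (integrableB mD ih ig).
by apply: filterS gh => x gh Dx; rewrite subr_ge0 gh.
Qed.

Lemma ae_eq0_Rintegral h : L1 h ->
  {ae P, forall x, D x -> 0 <= h x} -> 'E h = 0 ->
  {ae P, forall x, D x -> h x = 0}.
Proof.
move=> ih h0 Eh0.
have inh := integrable_norm ih.
have En : \int[P]_(x in D) `|h x| = 0.
  rewrite -Eh0; apply: ae_eq_Rintegral => //.
  by apply: filterS h0 => x h0 Dx; rewrite ger0_norm// h0.
have /(ae_eq_integral_abs P mD (measurable_int _ ih)) :
    (\int[P]_(x in D) `|(EFin \o h) x| = 0)%E.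
  by rewrite -(fineK (integrable_fin_num mD inh)); congr EFin.
by apply: filterS => x /[swap] Dx /(_ Dx)[].
Qed.

(** A density on one side of the constant 1 has its mass, so it is that constant. *)
Lemma ae_eq1_density theta : L1 theta -> 'E theta = 1 ->
  {ae P, forall x, D x -> 1 <= theta x} \/
  {ae P, forall x, D x -> theta x <= 1} ->
  {ae P, forall x, D x -> theta x = 1}.
Proof.
move=> it E1 [t1|t1].
- have : {ae P, forall x, D x -> theta x - 1 = 0}.
    apply: ae_eq0_Rintegral; first
      exact: (integrableB mD it (integrable_const 1)).
      by apply: filterS t1 => x t1 Dx; rewrite subr_ge0 t1.
    by rewrite RintegralB// Rintegral_const E1 subrr.
  by apply: filterS => x t0 Dx; apply/eqP; rewrite -subr_eq0 t0.
- have : {ae P, forall x, D x -> 1 - theta x = 0}.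
    apply: ae_eq0_Rintegral; first
      exact: (integrableB mD (integrable_const 1) it).
      by apply: filterS t1 => x t1 Dx; rewrite subr_ge0 t1.
    by rewrite RintegralB// Rintegral_const E1 subrr.
  by apply: filterS => x t0 Dx; apply/eqP; rewrite eq_sym -subr_eq0 t0.
Qed.

Lemma density1_mean W theta : L1 W -> L1 (fun x => W x * theta x) ->
  {ae P, forall x, D x -> theta x = 1} ->
  \int[P]_(x in D) (W x * theta x) = 'E W.
Proof.
move=> iW iWt t1; apply: ae_eq_Rintegral => //.
by apply: filterS t1 => x t1 Dx; rewrite t1// mulr1.
Qed.

(** Chebyshev's inequality for a density that increases with W.  With c the
    supremum of W over the points where theta < 1, monotonicity makes
    (W - c) (theta - 1) nonnegative. *)
Lemma comonotone_mean W theta (G : set T) : L1 W -> L1 theta ->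
  L1 (fun x => W x * theta x) -> 'E theta = 1 ->
  {ae P, forall x, D x -> G x} ->
  (forall x y, G x -> G y -> theta x < theta y -> W x <= W y) ->
  'E W <= \int[P]_(x in D) (W x * theta x).
Proof.
move=> iW it iWt E1 DG mon.
have [[x0 Gx0 x1]|nlt] := pselect (exists2 x, G x & theta x < 1); last first.
  rewrite (density1_mean iW iWt)//; apply: ae_eq1_density => //; left.
  apply: filterS DG => x Gx Dx; rewrite leNgt; apply/negP => xt.
  by apply: nlt; exists x => //; exact: Gx.
have [[y0 Gy0 y1]|ngt] := pselect (exists2 x, G x & 1 < theta x); last first.
  rewrite (density1_mean iW iWt)//; apply: ae_eq1_density => //; right.
  apply: filterS DG => x Gx Dx; rewrite leNgt; apply/negP => xt.
  by apply: ngt; exists x => //; exact: Gx.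
pose V := [set W x | x in [set x | G x /\ theta x < 1]].
have ubV y : G y -> 1 < theta y -> ubound V (W y).
  by move=> Gy ty _ [x [Gx tx] <-]; apply: mon => //; exact: lt_trans ty.
have V0 : V !=set0 by exists (W x0); exists x0.
have Vub : has_ubound V by exists (W y0); exact: ubV.
pose c := sup V.
have ict : L1 (fun x => c * theta x) by exact: (integrableZl mD c it).
have ic := integrable_const c.
have : 0 <= \int[P]_(x in D) ((W x * theta x - W x) - (c * theta x - c)).
  apply: ae_ge0_Rintegral.
    exact: (integrableB mD (integrableB mD iWt iW) (integrableB mD ict ic)).
  apply: filterS DG => x /[swap] Dx /(_ Dx) Gx.
  have -> : W x * theta x - W x - (c * theta x - c) = (W x - c) * (theta x - 1).
    by ring.
  have [xt|xt|->] := ltgtP (theta x) 1; last by rewrite subrr mulr0.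
  - rewrite mulr_le0// subr_le0 ?(ltW xt)//.
    by apply: ub_le_sup => //; exists x.
  - rewrite mulr_ge0// subr_ge0 ?(ltW xt)//.
    by apply: ge_sup => //; exact: ubV.
rewrite RintegralB//; [|exact: (integrableB mD iWt iW)|
                        exact: (integrableB mD ict ic)].
rewrite !RintegralB// RintegralZl// Rintegral_const E1.
by rewrite mulr1 subrr subr0 subr_ge0.
Qed.

(** A p-quantile of W: the supremum of the levels not exceeded with probability
    less than p.  Both bounds follow from continuity of the measure along
    monotone sequences of sublevel sets. *)
Lemma quantile_exists W (p : R) : measurable_fun D W -> 0 < p -> p < 1 ->
  exists s : R, (P (D `&` [set x | (W x < s)%R]) <= p%:E <=
                 P (D `&` [set x | (W x <= s)%R]))%E.
Proof.
move=> mW p0 p1; pose L t := D `&` [set x | W x <= t].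
have mL t : measurable (L t).
  rewrite [L t](_ : _ = D `&` W @^-1` `]-oo, t]) ?/L; first exact: mW.
  by congr (_ `&` _); apply/seteqP; split => x /=; rewrite in_itv.
have subL s t : s <= t -> L s `<=` L t.
  by move=> st x [Dx /= xs]; split => //=; exact: le_trans st.
have leL s t : s <= t -> (P (L s) <= P (L t))%E.
  by move=> st; apply: le_measure; rewrite ?inE//; exact: subL.
pose U := [set t | (P (L t) < p%:E)%E].
have Ulow s t : s <= t -> U t -> U s by move=> /leL /le_lt_trans; apply.
have U0 : U !=set0.
  have cL : bigcap setT (fun n : nat => L (- n%:R)) = set0.
    apply/seteqP; split => // x /= h.
    have [_ /=] := h (Num.truncn (- W x)).+1 I.
    rewrite lerNr leNgt => /negP; apply; exact: truncnS_gt.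
  have : (P \o (fun n : nat => L (- n%:R))) @ \oo --> P set0.
    rewrite -cL; apply: nonincreasing_cvg_mu => //=.
    - by rewrite (le_lt_trans (probability_le1 _ _)) ?ltry.
    - by rewrite cL.
    - by move=> m n mn; apply/subsetPset/subL; rewrite lerN2 ler_nat.
  rewrite measure0 => h; apply: contrapT => nU.
  have : (p%:E <= 0)%E; last by rewrite lee_fin leNgt p0.
  apply: (cvge_to_ge h); apply: nearW => n /=; rewrite leNgt; apply/negP => hn.
  by apply: nU; exists (- n%:R).
have Uub : has_ubound U.
  have cL : \bigcup_n L n%:R = D.
    apply/seteqP; split => [x [n _ []]//|x Dx].
    exists (Num.truncn (W x)).+1 => //; split => //=; apply: ltW; exact: truncnS_gt.
  have : (P \o (fun n : nat => L n%:R)) @ \oo --> P D.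
    rewrite -cL; apply: nondecreasing_cvg_mu => //=.
    - by rewrite cL.
    - by move=> m n mn; apply/subsetPset/subL; rewrite ler_nat.
  rewrite PD => h; apply: contrapT => nU.
  have : (1 <= p%:E)%E; last by rewrite lee_fin leNgt p1.
  apply: (cvge_to_le h); apply: nearW => n /=; rewrite leNgt; apply/negP => hn.
  apply: nU; exists n%:R => t Ut; rewrite leNgt; apply/negP => /ltW nt.
  by have := Ulow _ _ nt Ut; rewrite /U/= ltNge (ltW hn).
exists (sup U); apply/andP; split.
- have cL : \bigcup_n L (sup U - n.+1%:R^-1) = D `&` [set x | W x < sup U].
    apply/seteqP; split => [x [n _ [Dx /= xs]]|x [Dx /= xs]].
      by split => //=; apply: (le_lt_trans xs); rewrite ltrBlDr ltrDl invr_gt0.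
    have e0 : 0 < sup U - W x by rewrite subr_gt0.
    have [n _ /(_ n (leqnn _)) /= h] := near_infty_natSinv_lt (PosNum e0).
    exists n => //; split => //=. by rewrite lerBrDr -lerBrDl ltW.
  have : (P \o (fun n : nat => L (sup U - n.+1%:R^-1))) @ \oo
           --> P (D `&` [set x | W x < sup U]).
    rewrite -cL; apply: nondecreasing_cvg_mu => //=.
    - exact: bigcup_measurable.
    - move=> m n mn; apply/subsetPset/subL; rewrite lerD2l lerN2.
      by rewrite lef_pV2 ?posrE// ler_nat.
  move=> h; apply: (cvge_to_le h); apply: nearW => n /=.
  have e0 : 0 < n.+1%:R^-1 :> R by [].
  have [t Ut ts] := sup_adherent e0 (conj U0 Uub).
  exact: ltW (Ulow _ _ (ltW ts) Ut).
- have cL : bigcap setT (fun n => L (sup U + n.+1%:R^-1)) = L (sup U).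
    apply/seteqP; split => [x h|x [Dx /= xs] n _]; last first.
      by split => //=; rewrite (le_trans xs)// lerDl.
    split; first by have [] := h 0 I.
    rewrite /= leNgt; apply/negP => sx.
    have e0 : 0 < W x - sup U by rewrite subr_gt0.
    have [n _ /(_ n (leqnn _)) /= hn] := near_infty_natSinv_lt (PosNum e0).
    by have [_ /=] := h n I; rewrite -lerBlDl leNgt hn.
  have : (P \o (fun n : nat => L (sup U + n.+1%:R^-1))) @ \oo --> P (L (sup U)).
    rewrite -cL; apply: nonincreasing_cvg_mu => //=.
    - by rewrite (le_lt_trans (probability_le1 _ _)) ?ltry.
    - exact: bigcap_measurable.
    - move=> m n mn; apply/subsetPset/subL; rewrite lerD2l.
      by rewrite lef_pV2 ?posrE// ler_nat.
  move=> h; apply: (cvge_to_ge h); apply: nearW => n /=.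
  rewrite leNgt; apply/negP => hn.
  have : sup U + n.+1%:R^-1 <= sup U by apply: ub_le_sup.
  by rewrite gerDl leNgt invr_gt0 ltr0n.
Qed.

Definition antitone_in W g (al be : R) :=
  [/\ measurable_fun D g, forall x, al <= g x <= be &
      forall x y, D x -> D y -> W x <= W y -> g y <= g x].

Lemma antitone_in_L1 W g al be : antitone_in W g al be -> L1 g.
Proof.
move=> [mg bg _]; apply: measurable_bounded_integrable => //.
  by rewrite /= PD ltry.
exists (Num.max `|al| `|be|); split; first exact: num_real.
move=> M hM x Dx /=; apply: ltW; apply: le_lt_trans hM.
have /andP[ag gb] := bg x; rewrite le_max; have [g0|g0] := leP 0 (g x).
  by apply/orP; right; rewrite !ger0_norm// (le_trans g0).
by apply/orP; left; rewrite !ltr0_norm ?lerN2// (le_lt_trans ag).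
Qed.

Lemma antitone_in_L1M W g al be : L1 W -> antitone_in W g al be ->
  L1 (fun x => W x * g x).
Proof.
move=> iW [mg bg _]; apply: (@integrableMl _ _ _ P D mD (EFin \o W) g iW mg).
exists (Num.max `|al| `|be|); split; first exact: num_real.
move=> M hM x Dx /=; apply: ltW; apply: le_lt_trans hM.
have /andP[ag gb] := bg x; rewrite le_max; have [g0|g0] := leP 0 (g x).
  by apply/orP; right; rewrite !ger0_norm// (le_trans g0).
by apply/orP; left; rewrite !ltr0_norm ?lerN2// (le_lt_trans ag).
Qed.

Definition mix (t : R) g h := fun x : T => (1 - t) * g x + t * h x.

Lemma antitone_in_mix W g h al be t : 0 <= t <= 1 ->
  antitone_in W g al be -> antitone_in W h al be ->
  antitone_in W (mix t g h) al be.
Proof.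
move=> /andP[t0 t1] [mg bg ag] [mh bh ah]; split.
- by apply: measurable_funD; exact: measurable_funM.
- move=> x; have /andP[? ?] := bg x; have /andP[? ?] := bh x; rewrite /mix.
  by apply/andP; split; nra.
- move=> x y Dx Dy xy; rewrite lerD// ler_wpM2l ?subr_ge0//; first exact: ag.
  exact: ah.
Qed.

Lemma Rintegral_mix g h t : L1 g -> L1 h ->
  'E (mix t g h) = (1 - t) * 'E g + t * 'E h.
Proof.
move=> ig ih; rewrite RintegralD ?RintegralZl//; [exact: (integrableZl mD _ ig)|].
exact: (integrableZl mD _ ih).
Qed.

Lemma Rintegral_mixM W g h t :
  L1 (fun x => W x * g x) -> L1 (fun x => W x * h x) ->
  \int[P]_(x in D) (W x * mix t g h x) =
  (1 - t) * \int[P]_(x in D) (W x * g x) + t * \int[P]_(x in D) (W x * h x).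
Proof.
move=> ig ih; rewrite -Rintegral_mix//; apply: eq_Rintegral => x _.
by rewrite /mix; ring.
Qed.

(** This plays the role of the intermediate value theorem: means are affine along
    convex combinations of densities. *)
Lemma mix_attains (x c y : R) : x <= c -> c <= y ->
  exists2 t : R, 0 <= t <= 1 & (1 - t) * x + t * y = c.
Proof.
move=> xc cy; have [xy|yx] := ltP x y; last first.
  by exists 0; rewrite ?lexx ?ler01//; lra.
have d0 : 0 < y - x by rewrite subr_gt0.
exists ((c - x) / (y - x)); last by field; rewrite gt_eqF.
apply/andP; split; first by rewrite divr_ge0 ?subr_ge0// ltW.
by rewrite ler_pdivrMr// mul1r lerD2r.
Qed.

Definition step (al be : R) (A : set T) := fun x : T => al + (be - al) * \1_A x.

Lemma Rintegral_step al be (A : set T) : measurable A -> A `<=` D ->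
  'E (step al be A) = al + (be - al) * fine (P A).
Proof.
move=> mA AD; have iA : L1 (\1_A : T -> R).
  by apply: (integrableS measurableT) => //; exact: integrable_indic.
rewrite RintegralD//; last exact: (integrableZl mD _ iA).
by rewrite RintegralZl// Rintegral_const /Rintegral integral_indic// setIidl.
Qed.

Lemma antitone_in_step W al be (A : set T) : al <= be ->
  measurable A -> (forall x y, D x -> D y -> W x <= W y -> A y -> A x) ->
  antitone_in W (step al be A) al be.
Proof.
move=> ab mA Alow; split.
- apply: measurable_funD => //; exact: measurable_funM.
- by move=> x; rewrite /step indicE; case: (_ \in _) => /=; lra.
- move=> x y Dx Dy xy; rewrite /step !indicE.
  have [/set_mem Ay|_] := boolP (y \in A); last first.
    by rewrite mulr0 addr0 lerDl mulr_ge0// subr_ge0.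
  by rewrite (mem_set (Alow _ _ Dx Dy xy Ay)).
Qed.

(** Among the densities with values in [al, be], the one that jumps down from be
    to al at a quantile of W gives W the least mean.  Mixing the two possible
    values at the quantile adjusts the mass, and mixing the result with the
    constant 1 adjusts the mean of W. *)
Lemma bang_bang W theta al be : L1 W -> L1 theta ->
  L1 (fun x => W x * theta x) -> 'E theta = 1 ->
  \int[P]_(x in D) (W x * theta x) = 0 -> 0 < 'E W ->
  {ae P, forall x, D x -> al <= theta x <= be} ->
  exists g, [/\ antitone_in W g al be, 'E g = 1 &
                \int[P]_(x in D) (W x * g x) = 0].
Proof.
move=> iW it iWt E1 EW0 EW tab.
have nt1 : ~ {ae P, forall x, D x -> theta x = 1}.
  by move=> /(density1_mean iW iWt) h; move: EW; rewrite -h EW0 ltxx.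
have al1 : al < 1.
  rewrite ltNge; apply/negP => a1; apply: nt1; apply: ae_eq1_density => //; left.
  by apply: filterS tab => x h Dx; case/andP: (h Dx) => + _; exact: le_trans.
have be1 : 1 < be.
  rewrite ltNge; apply/negP => b1; apply: nt1; apply: ae_eq1_density => //; right.
  by apply: filterS tab => x h Dx; case/andP: (h Dx) => _ /le_trans; exact.
have ab : 0 < be - al by lra.
have mW : measurable_fun D W by apply/measurable_EFinP; exact: measurable_int iW.
(* The probability p at which a step from be down to al has mass 1. *)
pose p := (1 - al) / (be - al).
have p0 : 0 < p by rewrite divr_gt0// subr_gt0.
have p1 : p < 1 by rewrite ltr_pdivrMr// mul1r; lra.
have pE : al + (be - al) * p = 1 by rewrite /p; field; rewrite gt_eqF.
have [s /andP[ps sp]] := quantile_exists mW p0 p1.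
pose A := D `&` [set x | W x < s]; pose B := D `&` [set x | W x <= s].
have mA : measurable A.
  rewrite [A](_ : _ = D `&` W @^-1` `]-oo, s[) ?/A; first exact: mW.
  by congr (_ `&` _); apply/seteqP; split => x /=; rewrite in_itv.
have mB : measurable B.
  rewrite [B](_ : _ = D `&` W @^-1` `]-oo, s]) ?/B; first exact: mW.
  by congr (_ `&` _); apply/seteqP; split => x /=; rewrite in_itv.
have [AD BD] : A `<=` D /\ B `<=` D by split => x [].
(* The two steps differ at the quantile s only; their masses surround 1. *)
pose gm := step al be A; pose gp := step al be B.
have agm : antitone_in W gm al be.
  apply: antitone_in_step => //; first by lra.
  by move=> x y Dx Dy xy [_ /= ys]; split => //=; exact: le_lt_trans ys.
have agp : antitone_in W gp al be.
  apply: antitone_in_step => //; first by lra.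
  by move=> x y Dx Dy xy [_ /= ys]; split => //=; exact: le_trans ys.
have Egm : 'E gm <= 1.
  rewrite Rintegral_step// -pE lerD2l ler_wpM2l ?(ltW ab)//.
  by rewrite -lee_fin fineK// fin_num_measure.
have Egp : 1 <= 'E gp.
  rewrite Rintegral_step// -pE lerD2l ler_wpM2l ?(ltW ab)//.
  by rewrite -lee_fin fineK// fin_num_measure.
have [t t01 tE] := mix_attains Egm Egp.
pose g := mix t gm gp.
have ag : antitone_in W g al be by exact: antitone_in_mix.
have ig := antitone_in_L1 ag.
have iWg := antitone_in_L1M iW ag.
have Eg : 'E g = 1.
  by rewrite Rintegral_mix ?tE//; [exact: antitone_in_L1 agm|
                                   exact: antitone_in_L1 agp].
have g_lt x : D x -> W x < s -> g x = be.
  move=> Dx xs; rewrite /g /mix /gm /gp /step !indicE.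
  by rewrite !mem_set; [rewrite !mulr1; ring|split => //=; exact: ltW|split].
have g_gt x : D x -> s < W x -> g x = al.
  move=> Dx xs; rewrite /g /mix /gm /gp /step !indicE.
  rewrite !memNset; first by rewrite !mulr0; ring.
    by move=> [_ /=]; rewrite leNgt xs.
  by move=> [_ /=]; rewrite ltNge (ltW xs).
(* (W - s) (theta - g) is nonnegative because theta lies between al and be. *)
have EWg : \int[P]_(x in D) (W x * g x) <= 0.
  have : 0 <= \int[P]_(x in D)
      ((W x * theta x - W x * g x) - (s * theta x - s * g x)).
    have ist : L1 (fun x => s * theta x) by exact: (integrableZl mD s it).
    have isg : L1 (fun x => s * g x) by exact: (integrableZl mD s ig).
    apply: ae_ge0_Rintegral.
      exact: (integrableB mD (integrableB mD iWt iWg) (integrableB mD ist isg)).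
    apply: filterS tab => x /[swap] Dx /(_ Dx) /andP[ax xb].
    have -> : W x * theta x - W x * g x - (s * theta x - s * g x) =
      (W x - s) * (theta x - g x) by ring.
    have [xs|xs|->] := ltgtP (W x) s; last by rewrite subrr mul0r.
    - by rewrite (g_lt _ Dx xs) mulr_le0// subr_le0// ltW.
    - by rewrite (g_gt _ Dx xs) mulr_ge0// subr_ge0// ltW.
  have ist : L1 (fun x => s * theta x) by exact: (integrableZl mD s it).
  have isg : L1 (fun x => s * g x) by exact: (integrableZl mD s ig).
  rewrite RintegralB//; [|exact: (integrableB mD iWt iWg)|
                          exact: (integrableB mD ist isg)].
  by rewrite !RintegralB// !RintegralZl// E1 Eg EW0 subrr subr0 sub0r oppr_ge0.
have a1 : antitone_in W (fun=> 1) al be.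
  by split => // x; rewrite !ltW.
have iW1 : L1 (fun x => W x * 1) by under eq_fun do rewrite mulr1.
have EW1 : \int[P]_(x in D) (W x * 1) = 'E W.
  by apply: eq_Rintegral => x _; rewrite mulr1.
have [u u01 uE] := mix_attains EWg (ltW EW).
exists (mix u g (fun=> 1)); split.
- exact: antitone_in_mix.
- by rewrite Rintegral_mix// Eg Rintegral_const; ring.
- by rewrite Rintegral_mixM// EW1 uE.
Qed.

End probability_on_carrier.

(** * Densities satisfying the first-order conditions *)

Section first_order_condition.
Context d (T : measurableType d) (R : realType) (P : probability T R).
Variables (D : set T) (f : R -> R).
Implicit Types (W theta : T -> R).

(** The measure with density theta, of mass 1 and W-mean 0, is a stationary point
    of the Lagrangian with multipliers lambda and eta. *)
Definition foc_density W theta lambda eta :=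
  [/\ P.-integrable D (EFin \o theta),
      P.-integrable D (fun x => (W x * theta x)%:E),
      {ae P, forall x, D x ->
        subdifferential f (theta x) (- lambda - eta * W x)},
      \int[P]_(x in D) theta x = 1 &
      \int[P]_(x in D) (W x * theta x) = 0].

Hypotheses (mD : measurable D) (PD : P D = 1%E).

(** This reduces the case of a negative mean of S to that of a positive mean. *)
Lemma foc_densityN W theta lambda eta : foc_density W theta lambda eta ->
  foc_density (fun x => - W x) theta lambda (- eta).
Proof.
move=> [it iWt sub E1 E0].
have eqN : (fun x => - W x * theta x) = (fun x => (-1) * (W x * theta x)).
  by apply/funext => x; ring.
split=> //.
- rewrite -[X in _.-integrable _ X]/(EFin \o (fun x => - W x * theta x)) eqN.
  exact: (integrableZl mD (-1) iWt).
- by apply: filterS sub => x; rewrite mulrNN.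
- by rewrite eqN RintegralZl// E0 mulr0.
Qed.

(** Either theta >= 1 on A, or theta < 1 somewhere on A and therefore everywhere
    outside A.  In the first case theta adds mass to A, in the second it removes
    mass from the complement. *)
Lemma decreasing_density_mass theta (G A : set T) :
  P.-integrable D (EFin \o theta) -> \int[P]_(x in D) theta x = 1 ->
  {ae P, forall x, D x -> G x} -> measurable A ->
  (forall x y, G x -> G y -> A x -> ~ A y -> theta y <= theta x) ->
  (P (A `&` D) <= \int[P]_(x in A `&` D) (theta x)%:E)%E.
Proof.
move=> it E1 DG mA mon.
have mAD : measurable (A `&` D) by exact: measurableI.
have mCAD : measurable (~` A `&` D) by apply: measurableI => //; exact: measurableC.
have itA : P.-integrable (A `&` D) (EFin \o theta) by exact: integrableS it.
have itC : P.-integrable (~` A `&` D) (EFin \o theta) by exact: integrableS it.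
have i1 B : measurable B -> P.-integrable B (EFin \o (fun=> 1)).
  by move=> mB; exact: finite_measure_integrable_cst.
have c1 B : measurable B -> \int[P]_(x in B) (1 : R) = fine (P B).
  by move=> mB; rewrite Rintegral_cst// mul1r.
rewrite -(fineK (fin_num_measure P _ mAD)) -(fineK (integrable_fin_num mAD itA)).
rewrite lee_fin -[fine (integral _ _ _)]/(\int[P]_(x in A `&` D) theta x).
have [[x0 [Gx0 Ax0] x1]|nlt] := pselect (exists2 x, G x /\ A x & theta x < 1).
- have tC : \int[P]_(x in ~` A `&` D) theta x <= fine (P (~` A `&` D)).
    rewrite -c1//; apply: ae_le_Rintegral => //; first exact: i1.
    apply: filterS DG => x Gx [Ax Dx]; apply: le_trans (ltW x1).
    by apply: mon => //; exact: Gx.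
  have DE : D = (A `&` D) `|` (~` A `&` D) by rewrite -setIUl setUCr setTI.
  have dis : [disjoint A `&` D & ~` A `&` D].
    by apply/disj_set2P; rewrite setIACA setICr set0I.
  have sE : \int[P]_(x in A `&` D) theta x + \int[P]_(x in ~` A `&` D) theta x = 1.
    by rewrite -Rintegral_setU// -DE.
  have sP : fine (P (A `&` D)) + fine (P (~` A `&` D)) = 1.
    rewrite -!c1// -Rintegral_setU// -DE; first by rewrite c1//= PD.
    exact: i1.
  by lra.
- rewrite -c1//; apply: ae_le_Rintegral => //; first exact: i1.
  apply: filterS DG => x Gx [Ax Dx]; rewrite leNgt; apply/negP => x1.
  by apply: nlt; exists x => //; split => //; exact: Gx.
Qed.

Hypotheses (f_convex : convex_function (`]0, +oo[%classic : set R^o) f)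
  (f_ge0 : forall x, 0 < x -> 0 <= f x) (f1 : f 1 = 0)
  (f_infty : f_slope_infty f = +oo%E).

(** The multipliers may change: when eta = 0 the given theta need not be
    monotone, and it is replaced by an optimal density with lambda = eta = 0. *)
Lemma decreasing_foc_density W theta lambda eta :
  P.-integrable D (EFin \o W) -> 0 < \int[P]_(x in D) W x ->
  foc_density W theta lambda eta ->
  exists theta' lambda' eta', foc_density W theta' lambda' eta' /\
    exists G : set T, {ae P, forall x, D x -> G x} /\
      forall x y, G x -> G y -> W x < W y -> theta' y <= theta' x.
Proof.
move=> iW EW foc; have [it iWt sub E1 EW0] := foc.
have nt1 : ~ {ae P, forall x, D x -> theta x = 1}.
  by move=> /(density1_mean mD iW iWt) h; move: EW; rewrite -h EW0 ltxx.
pose G := [set x | subdifferential f (theta x) (- lambda - eta * W x)].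
have [eta0|eta0|eta0] := ltgtP eta 0.
- have : \int[P]_(x in D) W x <= \int[P]_(x in D) (W x * theta x).
    apply: (@comonotone_mean _ _ _ P D mD PD W theta G) => // x y Gx Gy xy.
    have := subdifferential_le f_convex f_ge0 f1 Gx Gy xy.
    by rewrite lerD2l lerN2 ler_nM2l.
  by rewrite EW0 leNgt EW.
- exists theta, lambda, eta; split => //; exists G; split => // x y Gx Gy.
  apply: contraTT; rewrite -!ltNge => xy.
  have := subdifferential_le f_convex f_ge0 f1 Gx Gy xy.
  by rewrite lerD2l lerN2 ler_pM2l// leNgt.
- have sub0 : {ae P, forall x, D x -> subdifferential f (theta x) (- lambda)}.
    apply: filterS sub => x sx Dx.
    by rewrite -[- lambda]subr0 -(mul0r (W x)) -eta0; exact: sx.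
  (* At 1, where f vanishes, the subgradient inequality says that
     lambda * (1 - theta) >= 0; its integral is 0. *)
  have lt0 : {ae P, forall x, D x -> 0 <= lambda * (1 - theta x)}.
    apply: filterS sub0 => x sx Dx; have [fx /(_ 1)] := sx Dx.
    have := f_ext_ge0 f_convex f_ge0 f1 (theta x).
    rewrite (f_ext1 f1) -(fineK (f_ext_fin_num f_convex f_ge0 f1 fx)).
    rewrite -EFinD !lee_fin.
    by lra.
  have lt_eq0 : {ae P, forall x, D x -> lambda * (1 - theta x) = 0}.
    have i1 : P.-integrable D (EFin \o (fun=> 1)).
      by apply: finite_measure_integrable_cst => //=; rewrite PD ltry.
    have i1t := integrableB mD i1 it.
    apply: ae_eq0_Rintegral => //; first exact: (integrableZl mD _ i1t).
    by rewrite RintegralZl// RintegralB// Rintegral_cst//= PD E1 mulr1 subrr mulr0.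
  have lambda0 : lambda = 0.
    apply: contrapT => /eqP l0; apply: nt1; apply: filterS lt_eq0 => x h Dx.
    by move/eqP: (h Dx); rewrite mulf_eq0 (negbTE l0)/= subr_eq0 => /eqP.
  have [al [be [al0 al1 be1 abE]]] := zero_set_itv f_convex f_ge0 f1 f_infty.
  have tab : {ae P, forall x, D x -> al <= theta x <= be}.
    apply: filterS sub0 => x sx Dx; apply/abE.
    have [fx /(_ 1)] := sx Dx; rewrite (f_ext1 f1) lambda0 oppr0 mul0r adde0 => fx0.
    by apply/eqP; rewrite eq_le fx0 f_ext_ge0.
  have [g [ag Eg EWg]] := bang_bang mD PD iW it iWt E1 EW0 EW tab.
  exists g, 0, 0; split.
    split => //.
    + exact: antitone_in_L1 ag.
    + exact: antitone_in_L1M ag.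
    + apply: aeW => x Dx; rewrite oppr0 mul0r subr0; apply: subdifferential0 => //.
      by apply/abE; case: ag.
  exists D; split; first exact: aeW.
  by case: ag => _ _ ag x y Dx Dy /ltW; exact: ag.
Qed.

End first_order_condition.

(** * Measures given by a density *)

Section density.
Context d (T : measurableType d) (R : realType).
Local Open Scope ereal_scope.

Lemma density_probability_exists (mu : {measure set T -> \bar R}) (h : T -> R) :
  measurable_fun setT h -> (forall x, (0 <= h x)%R) -> \int[mu]_x (h x)%:E = 1 ->
  exists nu : probability T R,
    forall A, measurable A -> nu A = \int[mu]_(x in A) (h x)%:E.
Proof.
move=> mh h0 h1; pose m (A : set T) := \int[mu]_(x in A) (h x)%:E.
have m0 : m set0 = 0 by rewrite /m integral_set0.
have m_ge0 A : 0 <= m A by apply: integral_ge0 => x _; rewrite lee_fin.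
have m_sa : semi_sigma_additive m.
  move=> /= F mF tF mUF; rewrite /m; apply: cvg_toP.
    apply: ereal_nondecreasing_is_cvgn => i j ij.
    by apply: lee_sum_nneg_natr => // k _ _; exact: m_ge0.
  rewrite ge0_integral_bigcup//=.
  - by apply/measurable_funTS/measurableT_comp.
  - by move=> x _; rewrite lee_fin.
pose M := isMeasure.Build _ _ _ m m0 m_ge0 m_sa.
pose mm : {measure set T -> \bar R} := HB.pack m M.
have mT : mm setT = 1 by exact: h1.
pose Q := Measure_isProbability.Build _ _ _ mm mT.
pose p : probability T R := HB.pack m M Q.
by exists p.
Qed.

Section change_of_measure.
Variables (nu mu : {finite_measure set T -> \bar R}) (h : T -> R).
Hypotheses (mh : measurable_fun setT h) (h0 : forall x, (0 <= h x)%R)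
  (nuE : forall A, measurable A -> nu A = \int[mu]_(x in A) (h x)%:E).

Let mEh E : measurable_fun E (EFin \o h).
Proof. by apply/measurable_EFinP; exact: measurable_funTS. Qed.

Lemma density_dominates : nu `<< mu.
Proof.
apply/null_content_dominatesP => A mA A0; rewrite nuE//.
exact: null_set_integral.
Qed.

Lemma density_integrable : mu.-integrable setT (EFin \o h).
Proof.
apply/integrableP; split; first exact: mEh.
under eq_integral => x _ do rewrite /= ger0_norm//.
by rewrite -nuE// ltey_eq fin_num_measure.
Qed.

(** The Radon-Nikodym derivative of nu is h almost everywhere. *)
Lemma ge0_integral_density E (g : T -> \bar R) : measurable E ->
  (forall x, 0 <= g x) -> measurable_fun E g ->
  \int[nu]_(x in E) g x = \int[mu]_(x in E) (g x * (h x)%:E).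
Proof.
move=> mE g0 mg; have dom := density_dominates.
rewrite -(Radon_Nikodym_SigmaFinite.change_of_variables dom g0 mE mg).
have mrn : measurable_fun E (Radon_Nikodym_SigmaFinite.f nu mu).
  apply/measurable_funTS/measurable_int.
  exact: Radon_Nikodym_SigmaFinite.f_integrable.
apply: ge0_ae_eq_integral => //.
- exact: emeasurable_funM.
- by apply: emeasurable_funM => //; exact: mEh.
- by move=> x _; rewrite mule_ge0// Radon_Nikodym_SigmaFinite.f_ge0.
- by move=> x _; rewrite mule_ge0// lee_fin.
- apply: ae_eqe_mul2l; apply: integral_ae_eq => //.
  + apply: (integrableS measurableT) => //.
    exact: Radon_Nikodym_SigmaFinite.f_integrable.
  + move=> A AE mA; rewrite -nuE//.
    by rewrite -Radon_Nikodym_SigmaFinite.f_integral.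
Qed.

Lemma integrable_density E (g : T -> R) : measurable E ->
  measurable_fun E g ->
  nu.-integrable E (EFin \o g) <-> mu.-integrable E (fun x => (g x * h x)%:E).
Proof.
move=> mE mg.
have mgE : measurable_fun E (EFin \o g) by exact/measurable_EFinP.
have mgh : measurable_fun E (fun x => (g x * h x)%:E).
  apply/measurable_EFinP; apply: measurable_funM => //; exact: measurable_funTS.
have intE : \int[nu]_(x in E) `|(g x)%:E| = \int[mu]_(x in E) `|(g x * h x)%:E|.
  rewrite ge0_integral_density//; last exact: measurableT_comp.
  by apply: eq_integral => x _ /=; rewrite normrM (ger0_norm (h0 x)) EFinM.
by split => /integrableP[_ goo]; apply/integrableP; split => //;
  move: goo; rewrite /= intE.
Qed.

Lemma integral_density E (g : T -> R) : measurable E ->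
  nu.-integrable E (EFin \o g) ->
  (\int[nu]_(x in E) g x = \int[mu]_(x in E) (g x * h x))%R.
Proof.
move=> mE ig; have mg := measurable_int _ ig; have dom := density_dominates.
congr fine; rewrite -[LHS](Radon_Nikodym_change_of_variables dom mE ig).
apply: ae_eq_integral => //.
- by apply: emeasurable_funM => //; exact: measurable_funTS.
- apply/measurable_EFinP; apply: measurable_funM.
    exact/measurable_EFinP.
  exact: measurable_funTS.
- under [X in ae_eq _ _ _ X]eq_fun do rewrite EFinM.
  apply: ae_eqe_mul2l; apply: integral_ae_eq => //.
  + by apply: (integrableS measurableT) => //; exact: Radon_Nikodym_integrable.
  + by move=> A AE mA; rewrite -nuE// -Radon_Nikodym_integral.
Qed.

(** The carrier of the singular part is mu-null, hence nu-null. *)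
Lemma singular_part_eq0 A : measurable A -> singular_part nu mu A = 0.
Proof.
move=> mA; have [mt t0 [N [mN N0 sN]] dec] := lebesgue_decompositionP nu mu.
have sN0 : singular_part nu mu N = 0.
  apply/eqP; rewrite eq_le measure_ge0 andbT.
  have : nu N = 0 by move/null_content_dominatesP : density_dominates; exact.
  move=> <-; rewrite dec// leeDr// integral_ge0// => x _.
  by rewrite lee_fin.
apply/eqP; rewrite eq_le measure_ge0 andbT.
apply: (@le_trans _ _ (singular_part nu mu (N `|` ~` N))).
  by apply: le_measure; rewrite ?inE ?setUCr.
by rewrite measureU0 ?sN0//; exact: measurableC.
Qed.

Lemma ac_density_ae E : measurable E ->
  ae_eq mu E (EFin \o h) (EFin \o ac_density nu mu).
Proof.
move=> mE; have [mt t0 _ dec] := lebesgue_decompositionP nu mu.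
apply: integral_ae_eq => //.
- by apply: (integrableS measurableT) => //; exact: density_integrable.
- by apply/measurable_EFinP; exact: measurable_funTS.
- by move=> A AE mA; rewrite -nuE// dec// singular_part_eq0// adde0.
Qed.

End change_of_measure.

(** The functions F and G may have infinite integrals, so k is split into its
    positive and negative parts, which have equal finite integrals, to compare
    nonnegative functions only. *)
Lemma le_integral_balanced (mu : {measure set T -> \bar R}) (D : set T)
    (F G : T -> \bar R) (k : T -> R) :
  measurable D -> measurable_fun D F -> measurable_fun D G ->
  (forall x, 0 <= F x) -> (forall x, 0 <= G x) ->
  mu.-integrable D (EFin \o k) -> (\int[mu]_(x in D) k x = 0)%R ->
  {ae mu, forall x, D x -> F x + (k x)%:E <= G x} ->
  \int[mu]_(x in D) F x <= \int[mu]_(x in D) G x.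
Proof.
move=> mD mF mG F0 G0 ik Ek FG.
pose kp := (EFin \o k)^\+; pose kn := (EFin \o k)^\-.
have ikp := integrable_funepos mD ik; have ikn := integrable_funeneg mD ik.
have kp_fin := integrable_fin_num mD ikp; have kn_fin := integrable_fin_num mD ikn.
have kpn : \int[mu]_(x in D) kp x = \int[mu]_(x in D) kn x.
  have : \int[mu]_(x in D) (k x)%:E = 0.
    rewrite -(fineK (integrable_fin_num mD ik)).
    by rewrite -[fine _]/(\int[mu]_(x in D) k x)%R Ek.
  rewrite integralE -/kp -/kn -(fineK kp_fin) -(fineK kn_fin) -EFinB => -[].
  by move=> /eqP; rewrite subr_eq0 => /eqP ->.
have : \int[mu]_(x in D) (F x + kp x) <= \int[mu]_(x in D) (G x + kn x).
  apply: ae_ge0_le_integral => //.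
  - by move=> x _; apply: adde_ge0 => //; exact: funepos_ge0.
  - by apply: emeasurable_funD => //; exact: measurable_int ikp.
  - by move=> x _; apply: adde_ge0 => //; exact: funeneg_ge0.
  - by apply: emeasurable_funD => //; exact: measurable_int ikn.
  - apply: filterS FG => x FG Dx.
    rewrite /kp /kn funeposE funenegE /=; have [k0|/ltW k0] := leP 0%R (k x).
      rewrite (max_idPl _) ?lee_fin// (max_idPr _) ?lee_fin ?oppr_le0//.
      by rewrite adde0 FG.
    rewrite (max_idPr _) ?lee_fin// (max_idPl _) ?lee_fin ?oppr_ge0//.
    by rewrite adde0 EFinN leeBrDr// FG.
have kp0 x : 0 <= kp x by exact: funepos_ge0.
have kn0 x : 0 <= kn x by exact: funeneg_ge0.
rewrite ge0_integralD//; last exact: measurable_int ikp.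
rewrite ge0_integralD//; last exact: measurable_int ikn.
by rewrite kpn leeD2rE.
Qed.

End density.

(** * Optimality *)

Section optimality.
Context (R : realType) (rho : \bar R) (mu : probability (measurableTypeR R) R).
Local Notation D := (nonneg_states rho).

Lemma measurable_nonneg_states : measurable (D : set (measurableTypeR R)).
Proof.
apply: is_interval_measurable => x y [x0 _] [_ yrho] z /andP[xz zy].
split; first exact: le_trans xz.
by apply: le_lt_trans yrho; rewrite lee_fin.
Qed.

Let mD := measurable_nonneg_states.

Variable f : R -> R.
Hypotheses (f_convex : convex_function (`]0, +oo[%classic : set R^o) f)
  (f_ge0 : forall x, 0 < x -> 0 <= f x) (f1 : f 1 = 0)
  (f_infty : f_slope_infty f = +oo%E).

Lemma f_divergence_density (nu : probability (measurableTypeR R) R) (h : R -> R) :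
  measurable_fun setT (h : measurableTypeR R -> R) -> (forall x, 0 <= h x) ->
  (forall A, measurable A -> nu A = (\int[mu]_(x in A) (h x)%:E)%E) ->
  f_divergence f rho nu mu = (\int[mu]_(x in D) f_ext f (h x))%E.
Proof.
move=> mh h0 nuE; rewrite /f_divergence (singular_part_eq0 mh nuE)// mule0 adde0.
have [mt _ _ _] := lebesgue_decompositionP nu mu.
have mfe := measurable_f_ext f_convex f_ge0 f1.
apply: ge0_ae_eq_integral => //.
- by apply: measurableT_comp => //; exact: measurable_funTS.
- by apply: measurableT_comp => //; exact: measurable_funTS.
- by move=> x _; exact: f_ext_ge0.
- by move=> x _; exact: f_ext_ge0.
- have := ac_density_ae mh h0 nuE mD.
  by apply: filterS => x /[swap] Dx /(_ Dx) /= [->].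
Qed.

Lemma f_divergence_singular (nu : probability (measurableTypeR R) R) :
  singular_part nu mu D != 0%E -> f_divergence f rho nu mu = +oo%E.
Proof.
move=> s0; rewrite /f_divergence f_infty gt0_mulye; last first.
  by rewrite lt_neqAle eq_sym s0 measure_ge0.
rewrite addey// gt_eqF// (@lt_le_trans _ _ 0%E)// integral_ge0// => x _.
exact: f_ext_ge0.
Qed.

(** The singular part does not charge the complement of [0, rho[ either, because
    nu does not. *)
Lemma singular_part_eq0_density (nu : probability (measurableTypeR R) R) :
  nu D = 1%E -> singular_part nu mu D = 0%E ->
  forall A, measurable A -> nu A = (\int[mu]_(x in A) (ac_density nu mu x)%:E)%E.
Proof.
move=> nuD s0 A mA; have [mt t0 _ dec] := lebesgue_decompositionP nu mu.
have nuC : nu (~` D) = 0%E.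
  by rewrite probability_setC// nuD subee.
have sC : singular_part nu mu (~` D) = 0%E.
  apply/eqP; rewrite eq_le measure_ge0 andbT -nuC dec; last exact: measurableC.
  by rewrite leeDr// integral_ge0// => x _; rewrite lee_fin.
have sT : singular_part nu mu setT = 0%E.
  by rewrite -(setUCr D) measureU0//; exact: measurableC.
rewrite dec// [X in (_ + X)%E](_ : _ = 0%E) ?adde0//.
apply/eqP; rewrite eq_le measure_ge0 andbT -sT.
by apply: le_measure; rewrite ?inE.
Qed.

(** The density is only nonnegative almost everywhere on [0, rho[, so nu is built
    from h, its positive part on [0, rho[ extended by 0. *)
Lemma foc_density_solves (S theta : R -> R) (lambda eta : R) :
  mu D = 1%E -> mu.-integrable D (EFin \o S) ->
  foc_density mu D f S theta lambda eta ->
  exists nu : probability (measurableTypeR R) R,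
    has_density rho mu theta nu /\ solves_G S f rho mu nu.
Proof.
move=> muD iS [it iSt sub E1 ES0].
have mS : measurable_fun D S by apply/measurable_EFinP; exact: measurable_int iS.
have mt : measurable_fun D theta by apply/measurable_EFinP; exact: measurable_int it.
have t0 : {ae mu, forall u, D u -> 0 <= theta u}.
  by apply: filterS sub => u su Du; exact: subdifferential_ge0 (su Du).
pose h : R -> R := (fun x => Num.max (theta x) 0) \_ D.
have mmax : measurable_fun D (fun x => Num.max (theta x) 0).
  exact: measurable_maxr.
have mh : measurable_fun setT (h : measurableTypeR R -> R).
  by apply/(measurable_restrictT _ mD).
have h0 x : 0 <= h x.
  by rewrite /h patchE; case: ifP => // _; rewrite le_max lexx orbT.
have ht : {ae mu, forall x, D x -> h x = theta x}.
  apply: filterS t0 => x t0 Dx; rewrite /h patchE mem_set//.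
  by rewrite (max_idPl _)// t0.
have hle x : D x -> `|h x| <= `|theta x|.
  move=> Dx; rewrite /h patchE mem_set//; rewrite maxEle; case: ifP => // _.
  by rewrite normr0.
have hE A : measurable A ->
    (\int[mu]_(x in A) (h x)%:E = \int[mu]_(x in A `&` D) (theta x)%:E)%E.
  move=> mA; transitivity (\int[mu]_(x in A `&` D) (Num.max (theta x) 0)%:E)%E.
    by rewrite integral_mkcondr restrict_EFin.
  have mAD : measurable (A `&` D) by exact: measurableI.
  apply: ae_eq_integral => //.
  - by apply/measurable_EFinP; apply: measurable_funS mmax.
  - by apply/measurable_EFinP; apply: measurable_funS mt.
  - by apply: filterS t0 => x t0 [_ Dx]; rewrite (max_idPl _)// t0.
have tE1 : (\int[mu]_(x in D) (theta x)%:E = 1)%E.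
  rewrite -(fineK (integrable_fin_num mD it)).
  by rewrite -[fine _]/(\int[mu]_(x in D) theta x) E1.
have hT : (\int[mu]_x (h x)%:E = 1)%E by rewrite hE// setTI.
have [nu nuE] := density_probability_exists mh h0 hT.
have nud : has_density rho mu theta nu by move=> A mA; rewrite nuE// hE.
exists nu; split => //.
have iSh : mu.-integrable D (fun x => (S x * h x)%:E).
  apply: (le_integrable mD _ _ iSt).
    apply/measurable_EFinP; apply: measurable_funM => //; exact: measurable_funTS.
  by move=> x Dx; rewrite /= lee_fin !normrM ler_wpM2l// hle.
have ih : mu.-integrable D (EFin \o h).
  apply: (le_integrable mD _ _ it).
    by apply/measurable_EFinP; exact: measurable_funTS.
  by move=> x Dx; rewrite /= lee_fin hle.
have ESh : \int[mu]_(x in D) (S x * h x) = 0.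
  rewrite -ES0; apply: ae_eq_Rintegral => //.
  by apply: filterS ht => x ht Dx; rewrite ht.
have Eh : \int[mu]_(x in D) h x = 1.
  by rewrite -E1; apply: ae_eq_Rintegral.
have iSnu : nu.-integrable D (EFin \o S).
  exact/(integrable_density mh h0 nuE mD mS).
split.
  split; last by rewrite /mean (integral_density mh nuE mD iSnu).
  by split => //; rewrite nud// setIid tE1.
move=> nu' [[nu'D iS'] mean'].
have [s0|/f_divergence_singular ->] := eqVneq (singular_part nu' mu D) 0%E;
  last exact: leey.
have [mt' t'0 _ _] := lebesgue_decompositionP nu' mu.
have nu'E := singular_part_eq0_density nu'D s0.
pose h' := ac_density nu' mu; rewrite -/h' in mt' t'0 nu'E.
rewrite (f_divergence_density mh h0 nuE) (f_divergence_density mt' t'0 nu'E).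
have ih' : mu.-integrable D (EFin \o h').
  apply: (integrableS measurableT) => //.
  exact: density_integrable mt' t'0 nu'E.
have iSh' : mu.-integrable D (fun x => (S x * h' x)%:E).
  exact/(integrable_density mt' t'0 nu'E mD mS).
have Eh' : \int[mu]_(x in D) h' x = 1.
  by rewrite /Rintegral -nu'E// nu'D.
have ESh' : \int[mu]_(x in D) (S x * h' x) = 0.
  by rewrite -(integral_density mt' nu'E mD iS').
(* The linear term of the subgradient inequality; it has zero integral. *)
pose k x := (- lambda) * (h' x - h x) + (- eta) * (S x * h' x - S x * h x).
have ik1 := integrableZl mD (- lambda) (integrableB mD ih' ih).
have ik2 := integrableZl mD (- eta) (integrableB mD iSh' iSh).
have mfe := measurable_f_ext f_convex f_ge0 f1.
apply: (@le_integral_balanced _ _ _ _ _ _ _ k mD).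
- by apply: measurableT_comp => //; exact: measurable_funTS.
- by apply: measurableT_comp => //; exact: measurable_funTS.
- by move=> x; exact: f_ext_ge0.
- by move=> x; exact: f_ext_ge0.
- exact: (integrableD mD ik1 ik2).
- rewrite /k RintegralD// !RintegralZl//; [|exact: (integrableB mD iSh' iSh)|
                                            exact: (integrableB mD ih' ih)].
  by rewrite !RintegralB// Eh Eh' ESh ESh' !subrr !mulr0 addr0.
- apply: filterS2 sub ht => x sx hx Dx; have [_ /(_ (h' x))] := sx Dx.
  rewrite /k hx//; apply: le_trans; rewrite le_eqVlt; apply/orP; left; apply/eqP.
  by congr (_ + _%:E)%E; ring.
Qed.

End optimality.

(** * Monotonicity of the scale function *)

Section scale_increasing.
Context {R : realType}.
Local Notation lbm := (@lebesgue_measure R).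

(** On [o, b] the oriented integral is an increment of an ordinary primitive based
    at o, which removes the case distinction on the order of the bounds. *)
Lemma oriented_integral_primitive (o c b : R) (g : R -> R) (u : R) :
  lbm.-integrable `[o, b] (EFin \o g) -> o <= c <= b -> o <= u <= b ->
  oriented_integral c u g =
  \int[lbm]_(t in `[o, u]) g t - \int[lbm]_(t in `[o, c]) g t.
Proof.
move=> ig /andP[oc cb] /andP[ou ub]; rewrite /oriented_integral.
have sub x y : o <= x -> y <= b -> lbm.-integrable `[x, y] (EFin \o g).
  move=> ox yb; apply: integrableS ig => //.
  by apply: subset_itvScc; rewrite bnd_simp.
have cat x y : o <= x -> x <= y -> y <= b ->
    \int[lbm]_(t in `[x, y]) g t =
    \int[lbm]_(t in `[o, y]) g t - \int[lbm]_(t in `[o, x]) g t.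
  move=> ox xy yb; rewrite Rintegral_itvB ?bnd_simp//; last exact: sub.
  rewrite Rintegral_itv_obnd_cbnd//; apply: integrableS (sub x y ox yb) => //.
  by apply: subset_itvr; rewrite bnd_simp.
have [cu|/ltW uc] := leP c u; first exact: cat.
by rewrite cat// opprB.
Qed.

Lemma Rintegral_continuous_gt0 (x y : R) (e : R -> R) : x < y ->
  {within `[x, y], continuous e} -> (forall t, 0 < e t) ->
  0 < \int[lbm]_(t in `[x, y]) e t.
Proof.
move=> xy ce e0; have [c _ emin] := EVT_min (ltW xy) ce.
have ie : lbm.-integrable `[x, y] (EFin \o e).
  by apply: continuous_compact_integrable => //; exact: segment_compact.
have ic : lbm.-integrable `[x, y] (EFin \o (fun=> e c)).
  apply: continuous_compact_integrable; first exact: segment_compact.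
  by move=> ?; exact: cvg_cst.
apply: (@lt_le_trans _ _ (\int[lbm]_(t in `[x, y]) e c)).
  rewrite Rintegral_cst//= lebesgue_measure_itv/= lte_fin xy -EFinB/=.
  by rewrite mulr_gt0// subr_gt0.
apply: le_Rintegral => // t txy; apply: emin; exact: txy.
Qed.

(** On [0, b] with b < rho, the drift quotient is integrable, so its primitive is
    continuous and the integrand of the scale function is continuous and
    positive; the scale function is its primitive. *)
Lemma scale_increasing (l rho : \bar R) (r0 : R) (a sigma : R -> R) :
  (l < 0)%E -> 0 < r0 -> (r0%:E < rho)%E ->
  measurable_fun (state_space l rho) a ->
  locally_integrable (state_space l rho) (fun x => (sigma x ^+ 2)^-1) ->
  locally_integrable (state_space l rho) (fun x => `|a x| / sigma x ^+ 2) ->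
  {in nonneg_states rho &, {homo scale a sigma r0 : x y / x < y}}.
Proof.
move=> l0 r00 r0rho ma [msV _ _] [_ oI locI] x y.
move=> /set_mem[x0 xrho] /set_mem[y0 yrho] xy.
pose I := state_space l rho.
pose b := Num.max r0 y.
have brho : (b%:E < rho)%E by rewrite /b maxEle; case: ifP.
have b0 : 0 <= b by rewrite le_max y0 orbT.
have bI : `[0, b] `<=` I.
  move=> t; rewrite /= in_itv/= => /andP[t0 tb]; split.
    by apply: (lt_le_trans l0); rewrite lee_fin.
  by apply: le_lt_trans brho; rewrite lee_fin.
pose g r := a r / sigma r ^+ 2.
have mI : measurable I by exact: open_measurable.
have mg : measurable_fun `[0, b] g.
  by apply: (measurable_funS mI bI); exact: measurable_funM.
have ig : lbm.-integrable `[0, b] (EFin \o g).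
  apply/integrableP; split; first exact/measurable_EFinP.
  have := locI _ bI (@segment_compact _ 0 b).
  apply: le_lt_trans; rewrite le_eqVlt; apply/orP; left; apply/eqP.
  apply: eq_integral => t _ /=; by rewrite /g !normrM normr_id.
pose G u := \int[lbm]_(t in `[0, u]) g t.
have cG : {within `[0, b], continuous G}.
  exact: parameterized_integral_continuous.
have r0b : 0 <= r0 <= b by rewrite (ltW r00) le_max lexx.
pose e u := expR (- 2 * oriented_integral r0 u g).
have eE : {in `[0, b], e =1 (fun u => expR (- 2 * (G u - G r0)))}.
  by move=> u; rewrite in_itv/= => ub; rewrite /e (oriented_integral_primitive ig).
have ce : {within `[0, b], continuous e}.
  apply: (@subspace_eq_continuous _ _ _ (fun u => expR (- 2 * (G u - G r0)))).
    by move=> u; rewrite inE => ub; exact/esym/eE.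
  move=> u; apply: (@continuous_comp (subspace `[0, b]) R R
    (fun u => - 2 * (G u - G r0)) expR); last exact: continuous_expR.
  by apply: cvgM; [exact: cvg_cst|apply: cvgB; [exact: cG|exact: cvg_cst]].
have ie : lbm.-integrable `[0, b] (EFin \o e).
  by apply: continuous_compact_integrable => //; exact: segment_compact.
have yb : y <= b by rewrite le_max lexx orbT.
have xb : x <= b by exact: le_trans (ltW xy) yb.
rewrite /scale !(oriented_integral_primitive ie) ?x0 ?y0// ltrD2r.
rewrite -subr_gt0 -[ltRHS](oriented_integral_primitive ie) ?x0 ?y0//.
rewrite /oriented_integral (ltW xy); apply: Rintegral_continuous_gt0 => //.
  by apply: continuous_subspaceW ce; apply: subset_itvScc; rewrite bnd_simp.
by move=> t; exact: expR_gt0.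
Qed.

End scale_increasing.

(** * Stochastic dominance *)

Section stochastic_dominance.
Context (R : realType) (rho : \bar R) (mu : probability (measurableTypeR R) R).
Local Notation D := (nonneg_states rho).
Hypothesis muD : mu D = 1%E.

(** For W = S the sets A are the half-lines ]-oo, x]; for W = - S they are the
    complements of these. *)
Lemma decreasing_density_mass_le (nu : probability (measurableTypeR R) R)
    (W theta : R -> R) (G A : set R) :
  mu.-integrable D (EFin \o theta) -> \int[mu]_(x in D) theta x = 1 ->
  has_density rho mu theta nu -> {ae mu, forall x, D x -> G x} ->
  (forall x y, G x -> G y -> W x < W y -> theta y <= theta x) ->
  measurable (A : set (measurableTypeR R)) ->
  (forall x y, D x -> D y -> A x -> ~ A y -> W x < W y) ->
  (mu A <= nu A)%E.
Proof.
move=> it E1 nud DG mon mA Alow; have mD := measurable_nonneg_states rho.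
have muC : mu (~` D) = 0%E by rewrite probability_setC// muD subee.
have -> : mu A = mu (A `&` D).
  rewrite -[in LHS](setUIDK A D) measureU//.
  - rewrite [X in (_ + X)%E](_ : _ = 0%E) ?adde0//.
    apply/eqP; rewrite eq_le measure_ge0 andbT -muC.
    by apply: le_measure; rewrite ?inE//; [exact: measurableD|exact: measurableC].
  - exact: measurableI.
  - exact: measurableD.
  - by rewrite setDE setIACA setICr setI0.
rewrite nud//; apply: (decreasing_density_mass mD muD it E1 (G := D `&` G)) => //.
  by apply: filterS DG => x Gx Dx; split => //; exact: Gx.
by move=> x y [Dx Gx] [Dy Gy] Ax Ay; apply: mon => //; exact: Alow.
Qed.

End stochastic_dominance.

(** * Optimal measures comparable with the reference measure *)

Theorem proposition13 (R : realType) (l rho : \bar R) (r0 : R)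
    (a sigma f : R -> R)
    (hl : (l < 0)%E) (hr0 : 0 < r0) (hrho : (r0%:E < rho)%E)
    (ma : measurable_fun (state_space l rho) a)
    (msigma : measurable_fun (state_space l rho) sigma)
    (sigma_pos : forall x, state_space l rho x -> 0 < sigma x ^+ 2)
    (loc_sigma :
      locally_integrable (state_space l rho) (fun x => (sigma x ^+ 2)^-1))
    (loc_a :
      locally_integrable (state_space l rho)
        (fun x => `|a x| / sigma x ^+ 2))
    (f_convex : convex_function (`]0, +oo[%classic : set R^o) f)
    (f_ge0 : forall x, 0 < x -> 0 <= f x)
    (f1 : f 1 = 0)
    (f_infty : f_slope_infty f = +oo%E)
    (S : R -> R) (SE : S = scale a sigma r0)
    (mu : probability (measurableTypeR R) R)
    (mu_P : prob_class S rho mu)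
    (theta : R -> R) (lambda eta : R)
    (theta_L1 : mu.-integrable (nonneg_states rho) (EFin \o theta))
    (theta_ge0 : {ae mu, forall u, nonneg_states rho u -> 0 <= theta u})
    (Stheta_L1 :
      mu.-integrable (nonneg_states rho) (fun u => (S u * theta u)%:E))
    (foc : {ae mu, forall u, nonneg_states rho u ->
              subdifferential f (theta u) (- lambda - eta * S u)})
    (theta_mass : \int[mu]_(u in nonneg_states rho) theta u = 1)
    (theta_mean : \int[mu]_(u in nonneg_states rho) (S u * theta u) = 0) :
  [/\ exists nu : probability (measurableTypeR R) R,
        has_density rho mu theta nu /\ solves_G S f rho mu nu,
      0 < mean S rho mu ->
        exists nuhat : probability (measurableTypeR R) R,
          solves_G S f rho mu nuhat /\ stoch_dominates mu nuhat &
      mean S rho mu < 0 ->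
        exists nuhat : probability (measurableTypeR R) R,
          solves_G S f rho mu nuhat /\ stoch_dominates nuhat mu].
Proof.
have [muD iS] := mu_P.
have mD := measurable_nonneg_states rho.
have Sincr : {in nonneg_states rho &, {homo S : x y / x < y}}.
  by rewrite SE; exact: scale_increasing hl hr0 hrho ma loc_sigma loc_a.
have foc0 : foc_density mu (nonneg_states rho) f S theta lambda eta by split.
have mItv (x : R) : measurable (`]-oo, x]%classic : set (measurableTypeR R)).
  exact: measurable_itv.
split.
- exact: foc_density_solves foc0.
- move=> mS; have [th [la [et [fth [G [DG mon]]]]]] :=
    decreasing_foc_density mD muD f_convex f_ge0 f1 f_infty iS mS foc0.
  have [nu [nud nuG]] :=
    foc_density_solves f_convex f_ge0 f1 f_infty muD iS fth.
  exists nu; split=> // x; have [it _ _ E1 _] := fth.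
  apply: (decreasing_density_mass_le muD it E1 nud DG mon) => // y z Dy Dz.
  rewrite /= !in_itv/= => yx /negP; rewrite -ltNge => xz.
  by apply: Sincr; rewrite ?inE//; exact: le_lt_trans xz.
- move=> mS; pose NS x := - S x.
  have iNS : mu.-integrable (nonneg_states rho) (EFin \o NS).
    exact: (integrableN iS).
  have mNS : 0 < \int[mu]_(x in nonneg_states rho) NS x.
    rewrite (_ : \int[mu]_(x in _) _ = - mean S rho mu) ?oppr_gt0//.
    rewrite -mulN1r /mean -RintegralZl//.
    by apply: eq_Rintegral => x _; rewrite mulN1r.
  have [th [la [et [fth [G [DG mon]]]]]] :=
    decreasing_foc_density mD muD f_convex f_ge0 f1 f_infty iNS mNS
      (foc_densityN mD foc0).
  have fthS := foc_densityN mD fth.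
  have NNS : (fun x => - NS x) = S by apply/funext => x; rewrite opprK.
  rewrite NNS in fthS.
  have [nu [nud nuG]] :=
    foc_density_solves f_convex f_ge0 f1 f_infty muD iS fthS.
  exists nu; split=> // x; have [it _ _ E1 _] := fth.
  have : (mu (~` `]-oo, x]) <= nu (~` `]-oo, x]))%E.
    apply: (decreasing_density_mass_le muD it E1 nud DG mon).
      exact: measurableC.
    move=> y z Dy Dz /=; rewrite !in_itv/= => /negP; rewrite -ltNge => xy.
    move=> /contrapT zx; rewrite /NS ltrN2.
    by apply: Sincr; rewrite ?inE//; exact: le_lt_trans xy.
  rewrite !probability_setC//.
  by rewrite -(fineK (fin_num_measure mu _ (mItv x)))
    -(fineK (fin_num_measure nu _ (mItv x))) -!EFinB !lee_fin lerD2l lerN2.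
Qed.
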